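(* Let $G$ be a finite group with an abelian subgroup $H$ of index two, let $S\subseteq G\setminus\{1_G\}$ be inverse-closed, and let $X=\mathrm{Cay}(G,S)$. If $gSg^{-1}=S$ for some $g\in G\setminus H$, then $A=\langle R(H),L_g\rangle$ is an abelian regular subgroup of $\mathrm{Aut}(X)$ of order $|G|$; in particular, $X$ is a Cayley graph of an abelian group. If moreover $g^2=1_G$, then $A\cong H\times C_2$.
   Context: For a group $G$ and an inverse-closed subset $S\subseteq G\setminus\{1_G\}$, $\mathrm{Cay}(G,S)$ is the graph with vertex set $G$ in which $g\sim h$ if and only if $hg^{-1}\in S$. A graph $X$ is a Cayley graph of a group $K$ if $X\cong\mathrm{Cay}(K,S')$ for some inverse-closed $S'\subseteq K\setminus\{1_K\}$. For $a\in G$, $R_a$ and $L_a$ denote the permutations $x\mapsto xa$ and $x\mapsto ax$ of $G$; for a subgroup $H\le G$, $R(H)=\{R_h:h\in H\}$. A permutation group is regular if it is transitive and all point stabilizers are trivial. $C_2$ is the cyclic group of order two. *)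

(* Defs.v *)
From mathcomp Require Import all_boot all_fingroup.

Set Implicit Arguments.
Unset Strict Implicit.
Unset Printing Implicit Defensive.

Import GroupScope.

(* Graphs are given by their adjacency relation on a finite vertex type; the
   group G of a Cayley graph is the whole of a finGroupType. *)

Definition connection_set (gT : finGroupType) (S : {set gT}) : Prop :=
  1 \notin S /\ (forall s, s \in S -> s^-1 \in S).

Definition cay (gT : finGroupType) (S : {set gT}) : rel gT :=
  fun g h => h * g^-1 \in S.

Definition graph_iso (T U : finType) (e : rel T) (e' : rel U) : Prop :=
  exists2 f : T -> U, bijective f & forall x y, e' (f x) (f y) = e x y.

Definition is_cayley_graph_of (T : finType) (e : rel T) (K : finGroupType) :
  Prop :=
  exists2 S' : {set K}, connection_set S' & graph_iso e (cay S').

Section GraphAut.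
Variables (T : finType) (e : rel T).

Definition graph_aut : {set {perm T}} :=
  [set s : {perm T} | [forall x, forall y, e (s x) (s y) == e x y]].

Lemma graph_aut_group_set : group_set graph_aut.
Proof.
apply/group_setP; split=> [|s t]; rewrite !inE.
  by apply/forallP=> x; apply/forallP=> y; rewrite !perm1.
move=> /forallP Hs /forallP Ht; apply/forallP=> x; apply/forallP=> y.
by rewrite !permM (eqP (forallP (Ht _) _)) (eqP (forallP (Hs _) _)).
Qed.

Canonical graph_aut_group := Group graph_aut_group_set.

End GraphAut.

(* {perm T} composes from left to right: (s * t) x = t (s x). This does not
   affect which subsets of {perm T} are subgroups, nor generated subgroups. *)

Definition Rtrans (gT : finGroupType) (a : gT) : {perm gT} := perm (mulIg a).

Definition Ltrans (gT : finGroupType) (a : gT) : {perm gT} := perm (mulgI a).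

Lemma RtransE (gT : finGroupType) (a x : gT) : Rtrans a x = x * a.
Proof. exact: permE. Qed.

Lemma LtransE (gT : finGroupType) (a x : gT) : Ltrans a x = a * x.
Proof. exact: permE. Qed.

Definition regular_perm (T : finType) (A : {set {perm T}}) : Prop :=
  [transitive A, on [set: T] | 'P] /\ (forall x : T, 'C_A[x | 'P] = 1).

(* Main.v *)
(** Left and right translations commute and [H] is abelian, so the generators
    of [A] commute pairwise; [A] is transitive because [G] is the disjoint union
    of [H] and [g H], and a transitive abelian permutation group is regular.
    Sabidussi's theorem, identifying a vertex [x] with the unique element of [A]
    taking [1] to [x], then exhibits the graph as a Cayley graph of [A]. *)

Require Import Defs.
From mathcomp Require Import all_boot all_fingroup all_algebra.
From mathcomp Require Import cyclic.

Set Implicit Arguments.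
Unset Strict Implicit.
Unset Printing Implicit Defensive.

Import GroupScope.

(** Since permutations compose from left to right, right translations give a homomorphism rather
    than an anti-homomorphism, so R(H) is a morphic image of [H]. *)
Lemma RtransM (gT : finGroupType) :
  {in [set: gT] &, {morph @Rtrans gT : a b / a * b}}.
Proof.
by move=> a b _ _; apply/permP=> x; rewrite permM !RtransE mulgA.
Qed.

Canonical Rtrans_morphism (gT : finGroupType) :=
  Morphism (@RtransM gT).

Lemma injm_Rtrans (gT : finGroupType) : 'injm (@Rtrans gT).
Proof.
by apply/injmP=> a b _ _ /permP/(_ 1); rewrite !RtransE !mul1g.
Qed.

Lemma LtransX (gT : finGroupType) (g x : gT) n :
  (Ltrans g ^+ n) x = g ^+ n * x.
Proof.
elim: n => [|n IHn]; first by rewrite perm1 mul1g.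
by rewrite expgSr permM IHn LtransE mulgA expgS.
Qed.

Lemma commute_Rtrans_Ltrans (gT : finGroupType) (a b : gT) :
  commute (Rtrans a) (Ltrans b).
Proof.
by apply/permP=> x; rewrite !permM !RtransE !LtransE mulgA.
Qed.

Lemma Rtrans_graph_aut (gT : finGroupType) (S : {set gT}) (a : gT) :
  Rtrans a \in graph_aut (cay S).
Proof.
rewrite inE; apply/forallP=> x; apply/forallP=> y.
by rewrite /cay !RtransE invMg mulgA mulgK.
Qed.

(** Left translation turns the quotient [y * x^-1] into its conjugate [g * (y * x^-1) * g^-1]; right
    translation leaves it unchanged. *)
Lemma Ltrans_graph_aut (gT : finGroupType) (S : {set gT}) (g : gT) :
  g *: S :* g^-1 = S -> Ltrans g \in graph_aut (cay S).
Proof.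
move=> conjS; rewrite inE; apply/forallP=> x; apply/forallP=> y.
rewrite /cay !LtransE invMg; have /setP <- := conjS.
rewrite mem_rcoset mem_lcoset invgK.
by rewrite !mulgA mulVg mul1g mulgKV.
Qed.

(** If [a] fixes [x] and [b] takes [x] to [y], then [a] commutes with [b] and so fixes [y] as
    well. *)
Lemma regular_abelian (T : finType) (A : {group {perm T}}) :
  abelian A -> [transitive A, on [set: T] | 'P] -> regular_perm A.
Proof.
move=> /centsP abA trA; split=> // x; apply/trivgP/subsetP=> a.
case/setIP=> Aa /astab1P ax; apply/set1P/permP=> y.
have [b Ab ->] := atransP2 trA (in_setT x) (in_setT y).
by rewrite perm1 /= /aperm -permM -(abA _ Aa _ Ab) permM; congr (b _).
Qed.

Lemma regular_inj (T : finType) (A : {group {perm T}}) (x : T) :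
  regular_perm A -> {in A &, injective (fun a : {perm T} => a x)}.
Proof.
case=> _ /(_ x) stab1 a b Aa Ab /= eq_ab.
apply/eqP; rewrite eq_mulgV1; apply/eqP/set1gP.
rewrite -stab1 inE groupM ?groupV //=.
by apply/astab1P; rewrite /= /aperm permM eq_ab permK.
Qed.

Lemma card_regular (T : finType) (A : {group {perm T}}) (x : T) :
  regular_perm A -> #|A| = #|T|.
Proof.
move=> regA; have [trA stabA] := regA.
by rewrite -cardsT -(atransP trA x (in_setT x)) card_orbit stabA indexg1.
Qed.

(* Sabidussi's theorem *)
Lemma regular_cayley (T : finType) (e : rel T) (A : {group {perm T}}) (x0 : T) :
    irreflexive e -> symmetric e -> A \subset graph_aut e -> regular_perm A ->
  is_cayley_graph_of e (subg_of A).
Proof.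
move=> irr_e sym_e autA regA.
have e_aut (a : subg_of A) x y : e (sgval a x) (sgval a y) = e x y.
  have := subsetP autA _ (subgP a); rewrite inE.
  by move=> /forallP/(_ x)/forallP/(_ y)/eqP.
pose ev (a : subg_of A) := sgval a x0.
have ev_inj : injective ev.
  move=> a b /(regular_inj regA) eq_ab; apply: subg_inj; apply: eq_ab;
  exact: subgP.
have [|f evK fK] := inj_card_bij ev_inj.
  by rewrite -(card_regular x0 regA) -cardsT (card_isog (isog_subg A)).
exists [set a | e x0 (ev a)].
  split=> [|a]; rewrite !inE /ev ?perm1 ?irr_e // => e0a.
  (* Applying [a] to the pair formed by [x0] and its image under [a^-1] gives the pair [ev a], [x0].
     The conversion refolds the product inside [subg_of A]. *)
  rewrite -(e_aut a) -permM -[sgval _ * _]/(sgval (a^-1 * a)) mulVg perm1.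
  by rewrite sym_e.
exists f; first by exists ev.
(* Applying [f x] to [x0] and its image under [f y * (f x)^-1] gives [ev (f x)] and [ev (f y)], that
   is, [x] and [y]. *)
move=> x y; rewrite /cay inE -(e_aut (f x)) /ev -permM.
rewrite -[sgval _ * _]/(sgval (f y * (f x)^-1 * f x)) mulgKV.
by rewrite -!/(ev _) !fK.
Qed.

Theorem lemma5p1 (gT : finGroupType) (H : {group gT}) (S : {set gT}) (g : gT)
    (abelH : abelian H) (indexH : #|[set: gT] : H| = 2)
    (connS : connection_set S)
    (gNH : g \notin H) (conjS : g *: S :* g^-1 = S) :
  let A := <<(@Rtrans gT @: H) :|: [set Ltrans g]>> in
  [/\ [/\ A \subset graph_aut (cay S), abelian A, regular_perm A
        & #|A| = #|[set: gT]|],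
      (exists2 K : finGroupType, abelian [set: K]
         & is_cayley_graph_of (cay S) K)
    & (g ^+ 2 = 1 -> A \isog setX H [set: 'Z_2])].
Proof.
move=> A; have [S1 SV] := connS.
pose RH := (@Rtrans gT @* H)%G.
have defRH : @Rtrans gT @: H = RH by rewrite /= morphimEsub ?subsetT.
have cRL : <[Ltrans g]> \subset 'C(RH).
  rewrite cycle_subG -defRH; apply/centP=> _ /imsetP[h _ ->].
  exact/commute_sym/commute_Rtrans_Ltrans.
have defA : A = RH * <[Ltrans g]>.
  by rewrite -cent_joinEr // joing_idr /A defRH.
have autA : A \subset graph_aut (cay S).
  rewrite gen_subG subUset sub1set Ltrans_graph_aut // andbT.
  by apply/subsetP=> _ /imsetP[h _ ->]; apply: Rtrans_graph_aut.
have abA : abelian A.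
  by rewrite defA abelianM morphim_abelian // cycle_abelian.
have RA h : h \in H -> Rtrans h \in A.
  by move=> Hh; rewrite mem_gen // inE imset_f.
have LA : Ltrans g \in A by rewrite mem_gen // !inE eqxx orbT.
have trA : [transitive A, on [set: gT] | 'P].
  apply/imsetP; exists 1; rewrite ?inE //; apply/esym/eqP.
  rewrite -subTset; apply/subsetP=> x _; apply/orbitP.
  have [Hx | xNH] := boolP (x \in H).
    by exists (Rtrans x); rewrite ?RA //= /aperm RtransE mul1g.
  (* The complement of [H] is the coset [H :* g], so [x * g^-1] lies in [H]; conjugating by [g],
     which normalizes [H], gives [g^-1 * x]. *)
  have Hgx : g^-1 * x \in H.
    have nHG : H <| [set: gT] by rewrite index2_normal ?subsetT.
    have := rcoset_index2 (subsetT H) indexH (x := g).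
    rewrite !inE gNH => /(_ isT) /setP/(_ x).
    rewrite !inE xNH mem_rcoset => Hxg.
    have gN : g \in 'N(H) by rewrite (subsetP (normal_norm nHG)) ?inE.
    by rewrite -(memJ_norm _ gN) conjgE mulgKV in Hxg.
  exists (Rtrans (g^-1 * x) * Ltrans g); first by rewrite groupM ?RA.
  by rewrite /= /aperm permM RtransE LtransE mul1g mulKVg.
have regA : regular_perm A by exact: regular_abelian.
split=> [||g2].
- by split=> //; rewrite cardsT (card_regular 1 regA).
- exists (subg_of <<(@Rtrans gT @: H) :|: [set Ltrans g]>>).
    by rewrite -(isog_abelian (isog_subg _)).
  apply: (regular_cayley 1) => // [x|x y]; rewrite /cay.
    by rewrite mulgV (negPf S1).
  by apply/idP/idP=> /SV; rewrite invMg invgK.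
(* A trivial [Ltrans g] would force [g = 1], an element of [H]. *)
have Lg2 : #[Ltrans g] = 2.
  apply: nt_prime_order => //.
    by apply/permP=> x; rewrite LtransX g2 mul1g perm1.
  apply: contraNneq gNH => /permP/(_ 1).
  by rewrite LtransE mulg1 perm1 => ->.
(* A subgroup of prime order meets [RH] trivially unless contained in it; evaluating
   [Ltrans g = Rtrans h] at 1 would give [g = h] in [H]. *)
have tiRL : RH :&: <[Ltrans g]> = 1.
  rewrite setIC; apply: prime_TIg; first by rewrite -orderE Lg2.
  rewrite cycle_subG -defRH; apply: contra gNH => /imsetP[h Hh /permP/(_ 1)].
  by rewrite LtransE RtransE mulg1 mul1g => ->.
have dA : RH \x <[Ltrans g]> = A by rewrite dprodE.
apply: (isog_dprod dA (setX_dprod H [set: 'Z_2])).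
  apply: isog_trans (isog_setX1 _ _).
  by rewrite isog_sym sub_isog ?subsetT ?injm_Rtrans.
apply: isog_trans (isog_set1X _ _).
by rewrite isog_cyclic_card ?cycle_cyclic //
  prime_cyclic -?orderE ?Lg2 cardsT card_ord.
Qed.
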